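(* Let $\Lambda=[0,\omega_1]$ be the standard closed long line. Then for each sequence $\vec{p}$ of positive integers, $S(\Lambda,\vec{p})$ is $\frac{1}{2}$-homogeneous.
   Context: For a cardinal $\kappa\ge 1$, a space $Y$ is $\frac1\kappa$-homogeneous if the action of its homeomorphism group $\operatorname{Homeo}(Y)$ on $Y$ has exactly $\kappa$ orbits. The standard long line $[0,\omega_1)$ is obtained from the ordinal $\omega_1$ by putting a copy of the open unit interval $(0,1)$ between $\alpha$ and $\alpha+1$ for each $\alpha\in\omega_1$, with the natural order topology; the standard closed long line $[0,\omega_1]$ adds $\omega_1$ as a last (compactifying) point. An ordered continuum is a nondegenerate compact connected space $\Lambda$ which has a linear order and whose topology is the order topology; $\partial\Lambda$ is the set consisting of its first and last points. For $n\ge 1$, $\Lambda^{(n)}=\Lambda_1\vee\dots\vee\Lambda_n$ denotes $n$ copies of $\Lambda$ laid end to end (the last point of $\Lambda_i$ is identified with the first point of $\Lambda_{i+1}$, orders preserved), and $\Sigma^{(n)}=\Lambda^{(n)}/\partial\Lambda^{(n)}$ is the ''circle'' obtained by identifying the first and last points of $\Lambda^{(n)}$; $\Sigma=\Sigma^{(1)}$. The identified endpoints of the copies of $\Lambda$ in $\Sigma^{(n)}$ are labeled in cyclic order $\infty_0,\dots,\infty_{n-1}$, and for $x\in\Lambda\setminus\partial\Lambda$, $\infty_i+x$ denotes the copy of $x$ in the $i$th copy of $\Lambda$ (the one starting at $\infty_i$). For positive integers $m,n$ the $m$-fold covering map $\phi^m_n:\Sigma^{(mn)}\to\Sigma^{(n)}$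 is given by $\phi^m_n(\infty_i)=\infty_j$ and $\phi^m_n(\infty_i+x)=\infty_j+x$, where $j=i \bmod n$. For a sequence $\vec{p}=\langle p_1,p_2,\dots\rangle$ of positive integers, put $k(1)=1$ and $k(n)=p_1p_2\cdots p_{n-1}$ for $n>1$, and let $S(\Lambda,\vec{p})=\varprojlim\{\phi^{p_n}_{k(n)},\Sigma^{(k(n))},n\in\mathbb{N}\}$, the inverse limit with bonding maps $\phi^{p_n}_{k(n)}:\Sigma^{(k(n+1))}\to\Sigma^{(k(n))}$. *)

(* Defs.v *)
From HB Require Import structures.
From mathcomp Require Import all_boot all_order all_algebra generic_quotient.
From mathcomp Require Import all_classical wochoice reals topology.

Set Implicit Arguments.
Unset Strict Implicit.
Unset Printing Implicit Defensive.

Import Order.TTheory GRing.Theory Num.Theory.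
Local Open Scope classical_set_scope.
Local Open Scope quotient_scope.

(** * Homogeneity *)

Definition homeomorphism (X Y : topologicalType) (h : X -> Y) : Prop :=
  continuous h /\
  exists g : Y -> X, [/\ continuous g, cancel h g & cancel g h].

Definition homeo_orbit (Y : topologicalType) (x : Y) : set Y :=
  [set h x | h in [set h : Y -> Y | homeomorphism h]].

(** The cardinal [kappa] is given by any set of that cardinality; [range] takes
    the set of all orbits. *)
Definition frac_homogeneous (U : Type) (kappa : set U) (Y : topologicalType) :
  Prop := (range (@homeo_orbit Y) #= kappa)%card.

(** * The closed long line *)

(** [W] is a copy of the ordinal omega_1, up to order isomorphism: an uncountable
    well-order all of whose proper initial segments are countable. *)
Definition is_omega1 (d : Order.disp_t) (W : orderType d) : Prop :=
  [/\ forall A : set W, A !=set0 -> exists2 x, A x & forall y, A y -> (x <= y)%O,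
      ~ countable [set: W]
    & forall x : W, countable [set y : W | (y < x)%O] ].

(** Existence of omega_1: in a well-order of the (uncountable) powerset of [nat],
    take the points that have countably many predecessors. *)
Section Omega1Exists.

Let R : rel (set nat) := sval (well_ordering_principle (set nat)).

Let R_wo : well_order R.
Proof. exact: svalP. Qed.

Let R_min (A : set (set nat)) : A !=set0 -> exists2 x, A x & forall y, A y -> R x y.
Proof.
case=> x Ax; have [|z [[zA zmin] _]] := R_wo (A := mem A).
  by exists x; rewrite mem_set.
by exists z => [|y Ay]; [exact: set_mem | apply: zmin; rewrite mem_set].
Qed.

Let R_total : total R.
Proof.
move=> x y; have [|z [->|->] /(_ _ _)h] := @R_min [set x; y]; first by exists x; left.
  by rewrite h//; right.
by rewrite (h x) ?orbT//; left.
Qed.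

Let R_refl : reflexive R.
Proof. by move=> x; have := R_total x x; rewrite orbb. Qed.

Let R_anti : antisymmetric R.
Proof.
move=> x y /andP[xy yx]; have [|z [_ zmin]] := R_wo (A := mem [set x; y]).
  by exists x; apply/mem_set; left.
rewrite -(zmin x) ?(zmin y)//; split; try by [apply/mem_set; left|apply/mem_set; right].
  by move=> t /set_mem[->|->].
by move=> t /set_mem[->|->].
Qed.

Let R_trans : transitive R.
Proof.
move=> y x z xy yz.
have [|t + h] := @R_min [set x; y; z]; first by exists x; left; left.
have tx : R t x by apply: h; left; left.
have ty : R t y by apply: h; left; right.
have tz : R t z by apply: h; right.
case=> [[et|et]|et]; rewrite et in tx ty tz.
- exact: tz.
- by rewrite (@R_anti x y) ?xy.
- by rewrite -(@R_anti y z) ?yz.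
Qed.

Let S : set (set nat) := [set x | countable [set y | R y x]].

Definition omega1 : Type := set_type S.
HB.instance Definition _ := Choice.on omega1.

Let le (x y : omega1) : bool := R (val x) (val y).

Let le_refl : reflexive le. Proof. by move=> x; exact: R_refl. Qed.

Let le_anti : antisymmetric le.
Proof. by move=> x y /R_anti /val_inj. Qed.

Let le_trans : transitive le.
Proof. by move=> y x z; exact: R_trans. Qed.

HB.instance Definition _ :=
  Order.Le_isPOrder.Build Order.default_display omega1 le_refl le_anti le_trans.

Let le_total : total (<=%O : rel omega1).
Proof. by move=> x y; exact: R_total. Qed.

HB.instance Definition _ :=
  Order.POrder_isTotal.Build Order.default_display omega1 le_total.

Let uncountable_sets : ~ countable [set: set nat].
Proof.
move=> /countable_injP[f finj]; pose D := [set n | exists2 A, f A = n & ~ A n].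
have [Df|Df] := pselect (D (f D)); last by apply: (Df); exists D.
case: (Df) => A fA; rewrite (finj A D) ?inE//.
Qed.

Let uncountable_S : ~ countable S.
Proof.
move=> cS; have [|x nSx xmin] := @R_min (~` S).
  apply: contrapT => /forallNP SN; apply: uncountable_sets.
  by apply: sub_countable cS; apply: subset_card_le => x _; exact: contrapT (SN x).
apply: nSx; apply: (@sub_countable _ _ _ (x |` S)).
  apply: subset_card_le => y yx; have [Sy|nSy] := pselect (S y); first by right.
  by left; apply: R_anti; rewrite yx xmin.
by rewrite -bigcup2E; apply: bigcup_countable => // -[|[|i]] _ /=.
Qed.

Lemma omega1_exists : exists (d : Order.disp_t) (W : orderType d), is_omega1 W.
Proof.
exists Order.default_display, omega1; split.
- move=> A [x Ax]; have [|_ [z Az <-] zmin] := @R_min (val @` A).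
    by exists (val x), x.
  by exists z => // y Ay; apply: zmin; exists y.
- move=> cW; apply: uncountable_S; apply: sub_countable cW.
  have -> : S = val @` [set: omega1]; last exact: card_image_le.
  apply/seteqP; split=> [x Sx|_ [x _ <-]]; last exact: (set_valP x).
  by exists (exist _ x (mem_set Sx)).
- move=> x; have := set_valP x; apply: sub_countable.
  rewrite -(card_le_eql (inj_card_eq (f := val) (A := [set y : omega1 | (y < x)%O]) _)).
    by apply: subset_card_le => _ [y /ltW yx <-].
  by move=> y z _ _; exact: val_inj.
Qed.

End Omega1Exists.

Definition unit_Ico (R : realType) : Type := {x : R | (0 <= x < 1)%R}.

HB.instance Definition _ (R : realType) :=
  SubType.copy (unit_Ico R) {x : R | (0 <= x < 1)%R}.
HB.instance Definition _ (R : realType) := [Choice of unit_Ico R by <:].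
HB.instance Definition _ (R : realType) :=
  [SubChoice_isSubOrder of unit_Ico R by <: with ring_display].

(** [(a, 0)] is the ordinal [a], and the points [(a, t)] with [0 < t < 1] are the
    copy of (0,1) inserted between [a] and [a + 1]. *)
Notation long_line W R :=
  (W *lexi[Order.lexi_display _ ring_display] unit_Ico R)%type.

(** [T] with a new last point [None]. *)
Definition add_last (T : Type) : Type := option T.

Section AddLast.
Context {d : Order.disp_t} {T : orderType d}.

HB.instance Definition _ := Choice.copy (add_last T) (option T).

Definition add_last_le (x y : add_last T) : bool :=
  match x, y with
  | _, None => true
  | None, Some _ => false
  | Some a, Some b => (a <= b)%O
  end.

Fact add_last_le_refl : reflexive add_last_le.
Proof. by case=> [a|] /=. Qed.

Fact add_last_le_anti : antisymmetric add_last_le.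
Proof. by move=> [a|] [b|] //= /le_anti ->. Qed.

Fact add_last_le_trans : transitive add_last_le.
Proof. by move=> [b|] [a|] [c|] //=; exact: le_trans. Qed.

HB.instance Definition _ := Order.Le_isPOrder.Build d (add_last T)
  add_last_le_refl add_last_le_anti add_last_le_trans.

Fact add_last_le_total : total (<=%O : rel (add_last T)).
Proof. by move=> [a|] [b|] //=; exact: le_total. Qed.

HB.instance Definition _ :=
  Order.POrder_isTotal.Build d (add_last T) add_last_le_total.

End AddLast.

Definition closed_long_line (d : Order.disp_t) (W : orderType d) (R : realType) :
    orderType (Order.lexi_display d ring_display) :=
  add_last (long_line W R).

(** * The circles [Sigma^(n)] and the covering maps between them *)

Section Circle.
Context {d : Order.disp_t} (L : orderType d).

(** The disjoint union of [n] copies of [L] with its order topology. *)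
Definition copies (n : nat) : topologicalType :=
  {i : 'I_n & order_topology L}.

Definition is_first (x : L) : bool := `[< forall y : L, (x <= y)%O >].
Definition is_last (x : L) : bool := `[< forall y : L, (y <= x)%O >].

(** The index [k] such that the point is to be glued to the node [infty_k], if
    any: [infty_k] is the first point of the [k]th copy of [L] and the last point
    of the preceding one, in the cyclic order given by [ordS]. *)
Definition node (n : nat) (u : copies n) : option 'I_n :=
  if is_first (tagged u) then Some (tag u)
  else if is_last (tagged u) then Some (ordS (tag u))
  else None.

Definition glue (n : nat) (u v : copies n) : bool :=
  (u == v) || (node u != None) && (node u == node v).

Fact glue_refl n : reflexive (@glue n).
Proof. by move=> u; rewrite /glue eqxx. Qed.

Fact glue_sym n : symmetric (@glue n).
Proof.
move=> u v; rewrite /glue eq_sym (eq_sym (node u) (node v)).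
by case: (node v =P node u) => [->|]; rewrite ?andbF.
Qed.

Fact glue_trans n : transitive (@glue n).
Proof.
move=> v u w /predU1P[-> //|/andP[nu /eqP uv]] /predU1P[<-|/andP[_ /eqP vw]].
  by rewrite /glue nu uv eqxx orbT.
by rewrite /glue nu uv vw eqxx orbT.
Qed.

Definition glue_equiv n := EquivRel (@glue n) (@glue_refl n) (@glue_sym n) (@glue_trans n).

(** Laying the [n] copies of [L] end to end and then identifying the first point
    with the last one amounts to a single quotient of their disjoint union. *)
Definition circle (n : nat) : topologicalType :=
  quotient_topology {eq_quot (glue_equiv n)}.

Definition circle_pt (n : nat) (i : 'I_n) (x : L) : circle n :=
  \pi_({eq_quot (glue_equiv n)}) (existT (fun=> order_topology L) i x).

Fact mod_ord_subproof (m n : nat) (i : 'I_(m * n)) : i %% n < n.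
Proof. by case: n i => [|n] i; [case: i => i; rewrite muln0 | rewrite ltn_pmod]. Qed.

Definition mod_ord (m n : nat) (i : 'I_(m * n)) : 'I_n :=
  Ordinal (mod_ord_subproof i).

(** Defined on representatives; [covering_pt] shows independence of the choice. *)
Definition covering (m n : nat) (z : circle (m * n)) : circle n :=
  let u := repr (z : {eq_quot (glue_equiv (m * n))}) in
  circle_pt (mod_ord (tag u)) (tagged u).

Fact mod_ordS (m n : nat) (i : 'I_(m * n)) : mod_ord (ordS i) = ordS (mod_ord i).
Proof.
apply/val_inj; rewrite /= modn_dvdm ?dvdn_mull//.
by rewrite -[in RHS]addn1 modnDml addn1.
Qed.

Fact node_mod (m n : nat) (i : 'I_(m * n)) (x : L) :
  node (existT (fun=> order_topology L) (mod_ord i) x) =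
  omap (@mod_ord m n) (node (existT (fun=> order_topology L) i x)).
Proof. by rewrite /node /=; do 2![case: ifP => //= _]; rewrite mod_ordS. Qed.

(** [infty_i |-> infty_(i %% n)] and [infty_i + x |-> infty_(i %% n) + x]. *)
Lemma covering_pt (m n : nat) (i : 'I_(m * n)) (x : L) :
  covering (circle_pt i x) = circle_pt (mod_ord i) x.
Proof.
rewrite /covering /circle_pt; case: piP => -[j y] /eqmodP /=.
case/predU1P => [[-> ->]//|/andP[n0 /eqP e]]; apply/eqmodP/orP; right.
by rewrite !node_mod -e eqxx andbT; case: node n0.
Qed.

End Circle.

(** * The solenoid *)

Definition inverse_limit (X : nat -> topologicalType)
    (f : forall n, X n.+1 -> X n) : topologicalType :=
  set_type [set x : prod_topology X | forall n, f n (x n.+1) = x n].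

(** The sequence [p] is indexed from 0: [p n] is p_(n+1), and [degree p n] is
    k(n+1), the product of the first [n] terms. *)
Fixpoint degree (p : nat -> nat) (n : nat) : nat :=
  if n is n'.+1 then p n' * degree p n' else 1.

Definition solenoid (d : Order.disp_t) (L : orderType d) (p : nat -> nat) :
    topologicalType :=
  @inverse_limit (fun n => circle L (degree p n))
    (fun n => @covering d L (p n) (degree p n)).

(* Main.v *)
Require Import Defs.
From mathcomp Require Import all_boot all_order all_algebra.
From mathcomp Require Import generic_quotient finmap zify ring lra.
From mathcomp Require Import all_classical reals topology.

(** A point of the solenoid is a coherent sequence of indices (a thread) together
    with a point of the closed long line other than its last point, so there are
    two candidates for orbits: the nodes, lying over the glued endpoints, and the
    other points.

    Each candidate is contained in one orbit.  A power of the cyclic shift of the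
    copies at every level, combined with an order automorphism of the closed long
    line performed in all copies at once, commutes with the coverings and hence
    acts on the solenoid ([solenoid_pt_homeo]).  Shifts move any thread to any
    other, and the order automorphisms are transitive on the interior of the
    closed long line ([interior_homogeneous]): two interior points lie below some
    countable ordinal [a], the initial segment below [a] is isomorphic to a real
    interval [[0, T)] by adding up summable weights on the countably many smaller
    ordinals ([segment_embedding]), and on [[0, T)] a piecewise affine map does
    the job; it is extended by the identity above [a].

    The two orbits differ because being the only common point of countably many
    neighbourhoods is invariant under homeomorphisms.  Non-nodes have this
    property since some interior point of the long line has it
    ([interior_Gdelta]).  Nodes do not ([node_not_Gdelta]): the copy of the long
    line that ends at a node gives a continuous path into it, and countably many
    neighbourhoods of omega_1 share further points since countable subsets of
    omega_1 are bounded. *)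

Set Implicit Arguments.
Unset Strict Implicit.
Unset Printing Implicit Defensive.

Import Order.TTheory GRing.Theory Num.Theory.
Local Open Scope classical_set_scope.
Local Open Scope quotient_scope.

(** * Order automorphisms *)

(** The inverse is a parameter because the homeomorphism that [f] induces on
    the solenoid has the map induced by [g] as its inverse. *)
Record order_auto d (L : orderType d) (f g : L -> L) : Prop := OrderAuto {
  order_auto_mono : {mono f : x y / (x <= y)%O};
  order_autoK : cancel f g;
  order_autoVK : cancel g f }.

Lemma order_auto_id d (L : orderType d) : order_auto (@id L) id.
Proof. by []. Qed.

Lemma order_auto_inv d (L : orderType d) (f g : L -> L) :
  order_auto f g -> order_auto g f.
Proof. by case=> fm fK gK; split=> // x y; rewrite -fm !gK. Qed.

Lemma order_auto_continuous d (T : orderTopologicalType d) (f g : T -> T) :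
  order_auto f g -> continuous f.
Proof.
case=> fm fK gK.
have E (y z : T) : ((f y < z)%O = (y < g z)%O) * ((z < f y)%O = (g z < y)%O).
  by rewrite -[z]gK !(leW_mono fm) gK.
move=> x U; rewrite itv_nbhsE => -[i [io xi] iU].
have fi : open (f @^-1` [set` i]).
  have L_open z : open (f @^-1` [set` `]-oo, z[%O]).
    rewrite (_ : _ @^-1` _ = [set` `]-oo, g z[%O]); first exact: lray_open.
    by apply/seteqP; split=> y; rewrite /= !in_itv /= E.
  have R_open z : open (f @^-1` [set` `]z, +oo[%O]).
    rewrite (_ : _ @^-1` _ = [set` `]g z, +oo[%O]); first exact: rray_open.
    by apply/seteqP; split=> y; rewrite /= !in_itv /= !andbT E.
  case: i io {xi iU} => [[[] l|[]] [[] r|[]]] //= _.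
  - rewrite set_itv_splitI preimage_setI; apply: openI.
      exact: R_open.
    exact: L_open.
  - by rewrite set_itvE preimage_setT; exact: openT.
apply: filterS (open_nbhs_nbhs (conj fi xi)).
by move=> y /iU.
Qed.

(** * Maps between inverse limits *)

Lemma inverse_limit_ext (X : nat -> topologicalType)
    (f : forall n, X n.+1 -> X n) (x y : inverse_limit f) :
  (forall n, val x n = val y n) -> x = y.
Proof. by move=> xy; apply/val_inj/functional_extensionality_dep. Qed.

Lemma inverse_limit_proj_continuous (X : nat -> topologicalType)
    (f : forall n, X n.+1 -> X n) n :
  continuous (fun x : inverse_limit f => val x n).
Proof.
move=> x; apply: (@continuous_comp (inverse_limit f) (prod_topology X) (X n)
  val (fun x : prod_topology X => x n)).
  exact: initial_continuous.
exact: (@proj_continuous _ X n (val x)).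
Qed.

Lemma inverse_limit_continuous (X : nat -> topologicalType)
    (f : forall n, X n.+1 -> X n) (Y : topologicalType)
    (g : Y -> inverse_limit f) :
  (forall n, continuous (fun y => val (g y) n)) -> continuous g.
Proof.
move=> gc; apply: continuous_comp_initial => y.
apply/cvg_sup => n U /= [_ [[V oV <-]] /= Vy] /filterS; apply.
by apply: (gc n y); exact: open_nbhs_nbhs.
Qed.

Section InverseLimitMap.
Variables (X : nat -> topologicalType) (f : forall n, X n.+1 -> X n).
Variable h : forall n, X n -> X n.
Hypothesis hf : forall n x, f (h x) = h (f x) :> X n.

Fact inverse_limit_map_subproof (x : inverse_limit f) :
  [set x : prod_topology X | forall n, f (x n.+1) = x n] (fun n => h (val x n)).
Proof. by move=> n /=; rewrite hf (set_valP x). Qed.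

Definition inverse_limit_map (x : inverse_limit f) : inverse_limit f :=
  SigSub (mem_set (inverse_limit_map_subproof x)).

Lemma inverse_limit_map_continuous :
  (forall n, continuous (@h n)) -> continuous inverse_limit_map.
Proof.
move=> hc; apply: inverse_limit_continuous => n x /=.
apply: (@continuous_comp _ _ _ (fun x : inverse_limit f => val x n) (@h n)).
  exact: inverse_limit_proj_continuous.
exact: hc.
Qed.

End InverseLimitMap.

Lemma inverse_limit_map_homeo (X : nat -> topologicalType)
    (f : forall n, X n.+1 -> X n) (h k : forall n, X n -> X n)
    (hf : forall n x, f n (h n.+1 x) = h n (f n x))
    (kf : forall n x, f n (k n.+1 x) = k n (f n x)) :
    (forall n, continuous (h n)) -> (forall n, continuous (k n)) ->
    (forall n, cancel (h n) (k n)) -> (forall n, cancel (k n) (h n)) ->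
  homeomorphism (inverse_limit_map hf).
Proof.
move=> hc kc hK kK; split; first exact: inverse_limit_map_continuous.
exists (inverse_limit_map kf); split; first exact: inverse_limit_map_continuous.
  by move=> x; apply: inverse_limit_ext => n /=; rewrite hK.
by move=> x; apply: inverse_limit_ext => n /=; rewrite kK.
Qed.

(** * The points and the topology of the circles *)

Lemma circle_continuous d (L : orderType d) n (Y : topologicalType)
    (f : circle L n -> Y) :
  (forall i, continuous (f \o @circle_pt d L n i : order_topology L -> Y)) ->
  continuous f.
Proof.
move=> fc; apply/quotient_continuous => -[i x] U Ux; exact: (fc i x U Ux).
Qed.

Lemma circle_pt_continuous d (L : orderType d) n (i : 'I_n) :
  continuous (@circle_pt d L n i : order_topology L -> circle L n).
Proof.
move=> x; apply: (@continuous_comp _ (copies L n) (circle L n)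
  (existT (fun=> order_topology L) i) (\pi_({eq_quot (glue_equiv L n)}))).
  exact: existT_continuous.
exact: pi_continuous.
Qed.

Lemma circle_ptP d (L : orderType d) n (i j : 'I_n) (x y : L) :
  circle_pt i x = circle_pt j y <->
  Defs.glue (existT (fun=> order_topology L) i x)
    (existT (fun=> order_topology L) j y).
Proof. by split=> [/eqmodP|g]; last exact/eqmodP. Qed.

Lemma circle_ptE d (L : orderType d) n (z : circle L n) :
  exists i x, z = circle_pt i x.
Proof.
exists (tag (repr z)), (tagged (repr z)).
by rewrite /circle_pt -[LHS]reprK; case: (repr z).
Qed.

Section Circle.
Context {d : Order.disp_t} (L : orderType d) (o e : L).
Hypotheses (oP : forall x, (o <= x)%O) (eP : forall x, (x <= e)%O).
Hypothesis oe : o != e.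

Lemma is_firstE x : is_first x = (x == o).
Proof.
by apply/asboolP/eqP => [xP|-> //]; apply/le_anti; rewrite xP oP.
Qed.

Lemma is_lastE x : is_last x = (x == e).
Proof.
by apply/asboolP/eqP => [xP|-> //]; apply/le_anti; rewrite xP eP.
Qed.

Lemma circle_pt_last n (i : 'I_n) : circle_pt i e = circle_pt (ordS i) o.
Proof.
apply/circle_ptP; rewrite /Defs.glue /node /= !is_firstE !is_lastE !eqxx.
by rewrite (eq_sym e) (negbTE oe) eqxx orbT.
Qed.

(** Leaving out the last point of each copy, which is the first point of the
    next one, gives every point of the circle exactly one pair of coordinates;
    this treats nodes and other points alike. *)
Lemma circle_pt_repr n (z : circle L n) :
  exists i x, x != e /\ z = circle_pt i x.
Proof.
have [i [x ->]] := circle_ptE z; have [->|xe] := eqVneq x e; last by exists i, x.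
by exists (ordS i), o; rewrite circle_pt_last.
Qed.

Lemma circle_pt_inj n (i j : 'I_n) x y : x != e -> y != e ->
  circle_pt i x = circle_pt j y -> i = j /\ x = y.
Proof.
move=> xe ye /circle_ptP/predU1P[[-> ->] //|].
rewrite /node /= !is_firstE !is_lastE (negbTE xe) (negbTE ye).
case: (x =P o) => // ->; case: (y =P o) => [->|//] /= /eqP[->].
by [].
Qed.

End Circle.

(** * The action on the circles *)

Section CircleMap.
Context {d : Order.disp_t} (L : orderType d) (n : nat).
Variables (s : 'I_n -> 'I_n) (f : L -> L).

(** Defined on representatives; [circle_map_pt] shows independence of the choice
    when [s] commutes with the cyclic successor and [f] is an automorphism. *)
Definition circle_map (z : circle L n) : circle L n :=
  let u := repr (z : {eq_quot (glue_equiv L n)}) in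
  circle_pt (s (tag u)) (f (tagged u)).

Variable g : L -> L.
Hypotheses (fg : order_auto f g) (sS : forall i, s (ordS i) = ordS (s i)).

Let is_first_auto x : is_first (f x) = is_first x.
Proof.
case: fg => fm _ gK; apply/asboolP/asboolP => fx y.
  by rewrite -fm fx.
by rewrite -[y]gK fm fx.
Qed.

Let is_last_auto x : is_last (f x) = is_last x.
Proof.
case: fg => fm _ gK; apply/asboolP/asboolP => fx y.
  by rewrite -fm fx.
by rewrite -[y]gK fm fx.
Qed.

Lemma circle_map_pt i x : circle_map (circle_pt i x) = circle_pt (s i) (f x).
Proof.
have node_map j y : node (existT (fun=> order_topology L) (s j) (f y)) =
    omap s (node (existT (fun=> order_topology L) j y)).
  rewrite /node /= is_first_auto is_last_auto.
  by do 2![case: ifP => //= _]; rewrite sS.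
rewrite /circle_map /circle_pt; case: piP => -[j y] /eqmodP /=.
case/predU1P => [[-> ->]//|/andP[n0 /eqP e]]; apply/eqmodP/orP; right.
by rewrite !node_map -e eqxx andbT; case: node n0.
Qed.

Lemma circle_map_continuous : continuous circle_map.
Proof.
apply: circle_continuous => i.
rewrite (_ : _ \o _ = @circle_pt d L n (s i) \o f); last first.
  by apply/funext => x; rewrite /= circle_map_pt.
move=> x; apply: (@continuous_comp (order_topology L) (order_topology L)).
  (* [order_topology L] has the order of [L] in another order structure, so
     the automorphism has to be repackaged. *)
  case: fg => fm fK gK; apply: (@order_auto_continuous _ (order_topology L) f g).
  by split.
exact: circle_pt_continuous.
Qed.

End CircleMap.

Lemma circle_map_cancel d (L : orderType d) n (s t : 'I_n -> 'I_n)
    (f g : L -> L) :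
    order_auto f g ->
    (forall i, s (ordS i) = ordS (s i)) ->
    (forall i, t (ordS i) = ordS (t i)) ->
    cancel s t ->
  cancel (circle_map s f) (circle_map t g).
Proof.
move=> fg sS tS sK z; have [i [x ->]] := circle_ptE z.
rewrite (circle_map_pt fg)// (circle_map_pt (order_auto_inv fg))// sK.
by rewrite (order_autoK fg).
Qed.

(** The power of the cyclic shift that maps [i] to [j]. *)
Definition rotation n (i j : 'I_n) : 'I_n -> 'I_n :=
  iter (j + (n - i)) (@ordS n).

Lemma val_rotation n (i j l : 'I_n) :
  rotation i j l = (l + (j + (n - i))) %% n :> nat.
Proof.
rewrite /rotation; elim: (_ + _)%N => [|a IH] /=.
  by rewrite addn0 modn_small.
by rewrite IH addnS -addn1 modnDml addn1.
Qed.

Lemma rotation_ordS n (i j l : 'I_n) :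
  rotation i j (ordS l) = ordS (rotation i j l).
Proof. by rewrite /rotation -iterSr. Qed.

Lemma rotationE n (i j : 'I_n) : rotation i j i = j.
Proof.
apply/val_inj; rewrite /= val_rotation addnC -addnA (subnK (ltnW (ltn_ord i))).
by rewrite modnDr modn_small.
Qed.

Lemma rotationK n (i j : 'I_n) : cancel (rotation i j) (rotation j i).
Proof.
move=> l; apply/val_inj; rewrite /= !val_rotation modnDml -addnA.
have -> : (j + (n - i) + (i + (n - j)) = n + n)%N.
  have := ltn_ord i; have := ltn_ord j; lia.
by rewrite addnA !modnDr modn_small.
Qed.

(** Rotations chosen along two threads are compatible with the coverings. *)
Lemma mod_ord_rotation m n (i j l : 'I_(m * n)) :
  mod_ord (rotation i j l) = rotation (mod_ord i) (mod_ord j) (mod_ord l).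
Proof.
apply/val_inj; rewrite /= !val_rotation /= modn_dvdm ?dvdn_mull//.
have n0 : (0 < n)%N by case: n i {j l} => // -[] ?; rewrite muln0.
apply/eqP; rewrite -modnDm -[eqbRHS]modnDm !modn_mod eqn_modDl.
rewrite !modn_mod -modnDm -[eqbRHS]modnDm !modn_mod eqn_modDl.
rewrite !modn_mod -(eqn_modDr i) (subnK (ltnW (ltn_ord i))) modnMl.
by rewrite -modnDmr subnK ?modnn// ltnW// ltn_pmod.
Qed.

(** * Coordinates and homeomorphisms of the solenoid *)

Section Solenoid.
Context {d : Order.disp_t} (L : orderType d) (o e : L) (p : nat -> nat).
Hypotheses (oP : forall x, (o <= x)%O) (eP : forall x, (x <= e)%O).
Hypothesis oe : o != e.

Definition thread (i : forall n, 'I_(degree p n)) : Prop :=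
  forall n, @mod_ord (p n) (degree p n) (i n.+1) = i n.

Fact solenoid_pt_subproof i (it : thread i) (x : L) :
  [set z : prod_topology (fun n => circle L (degree p n)) |
    forall n, @covering d L (p n) (degree p n) (z n.+1) = z n]
  (fun n => circle_pt (i n) x).
Proof. by move=> n; rewrite /= covering_pt it. Qed.

Definition solenoid_pt i (it : thread i) (x : L) : solenoid L p :=
  SigSub (mem_set (solenoid_pt_subproof it x)).

Lemma solenoid_pt_continuous i (it : thread i) :
  continuous (solenoid_pt it : order_topology L -> solenoid L p).
Proof.
apply: inverse_limit_continuous => n.
exact: (@circle_pt_continuous d L (degree p n) (i n)).
Qed.

Lemma solenoid_pt_inj i j (it : thread i) (jt : thread j) x y :
  x != e -> y != e -> solenoid_pt it x = solenoid_pt jt y ->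
  (forall n, i n = j n) /\ x = y.
Proof.
move=> xe ye E.
have {}E n : i n = j n /\ x = y.
  apply: (circle_pt_inj oP eP xe ye).
  exact: (congr1 (fun z : solenoid L p => val z n) E).
by split=> [n|]; [have [] := E n | have [] := E 0].
Qed.

Lemma solenoid_pt_repr (z : solenoid L p) :
  exists x i (it : thread i), x != e /\ z = solenoid_pt it x.
Proof.
(* The coordinates at the successive levels agree by uniqueness, because the
   coverings do not change the coordinate in [L]. *)
have ex : forall n, exists ix : 'I_(degree p n) * L,
    ix.2 != e /\ val z n = circle_pt ix.1 ix.2.
  by move=> n; have [i [x xP]] := circle_pt_repr oP eP oe (val z n); exists (i, x).
pose i n := sval (cid (ex n)).
have ix n : (i n).2 != e /\ val z n = circle_pt (i n).1 (i n).2.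
  exact: (svalP (cid (ex n))).
have iS n : @mod_ord (p n) (degree p n) (i n.+1).1 = (i n).1 /\
    (i n.+1).2 = (i n).2.
  have [[nS zS] [n0 zn]] := (ix n.+1, ix n).
  apply: (circle_pt_inj oP eP nS n0).
  by rewrite -zn -(set_valP z n) zS covering_pt.
have x0 n : (i n).2 = (i 0).2.
  by elim: n => // n <-; have [] := iS n.
have it : thread (fun n => (i n).1) by move=> n; have [] := iS n.
exists (i 0).2, (fun n => (i n).1), it; split; first by have [] := ix 0.
apply: inverse_limit_ext => n /=; rewrite -(x0 n); by have [] := ix n.
Qed.

(** The rotation that maps [i n] to [j n] at level [n], together with [f] in
    every copy of [L], commutes with the coverings. *)
Lemma solenoid_pt_homeo i j (it : thread i) (jt : thread j) (f g : L -> L) x :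
  order_auto f g ->
  exists2 h : solenoid L p -> solenoid L p, homeomorphism h &
    h (solenoid_pt it x) = solenoid_pt jt (f x).
Proof.
move=> fg; have gf := order_auto_inv fg.
have comm (u v : forall n, 'I_(degree p n)) (a b : L -> L) :
    thread u -> thread v -> order_auto a b ->
    forall n (z : circle L (degree p n.+1)),
    @covering d L (p n) (degree p n)
      (circle_map (rotation (u n.+1) (v n.+1)) a z) =
    circle_map (rotation (u n) (v n)) a (@covering d L (p n) (degree p n) z).
  move=> ut vt ab n z; have [l [y ->]] := circle_ptE z.
  rewrite (circle_map_pt ab (rotation_ordS _ _)) [LHS](covering_pt (m := p n)).
  rewrite [in RHS](covering_pt (m := p n)).
  by rewrite (circle_map_pt ab (rotation_ordS _ _)) mod_ord_rotation ut vt.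
exists (@inverse_limit_map _ _ (fun n => circle_map (rotation (i n) (j n)) f)
  (comm _ _ _ _ it jt fg)).
  apply: (@inverse_limit_map_homeo _ _ _
    (fun n => circle_map (rotation (j n) (i n)) g) _ (comm _ _ _ _ jt it gf)).
  - by move=> n; exact: (circle_map_continuous fg (rotation_ordS _ _)).
  - by move=> n; exact: (circle_map_continuous gf (rotation_ordS _ _)).
  - move=> n; apply: (circle_map_cancel fg); try exact: rotation_ordS.
    exact: rotationK.
  - move=> n; apply: (circle_map_cancel gf); try exact: rotation_ordS.
    exact: rotationK.
apply: inverse_limit_ext => n /=.
by rewrite (circle_map_pt fg (rotation_ordS _ _)) rotationE.
Qed.

End Solenoid.

(** * Orbits *)

Lemma homeo_orbit_refl (Y : topologicalType) (x : Y) : homeo_orbit x x.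
Proof. by exists id => //; split; [|exists id]; do ?split => //; move=> ? ?. Qed.

Lemma homeo_comp (X Y Z : topologicalType) (f : X -> Y) (g : Y -> Z) :
  homeomorphism f -> homeomorphism g -> homeomorphism (g \o f).
Proof.
move=> [fc [f' [f'c fK f'K]]] [gc [g' [g'c gK g'K]]]; split.
  by move=> x; apply: continuous_comp; [exact: fc | exact: gc].
exists (f' \o g'); split; try exact: can_comp.
by move=> x; apply: continuous_comp; [exact: g'c | exact: f'c].
Qed.

Lemma homeo_orbit_eq (Y : topologicalType) (h : Y -> Y) (x : Y) :
  homeomorphism h -> homeo_orbit (h x) = homeo_orbit x.
Proof.
move=> hh; apply/seteqP; split=> _ [k /= kh <-].
  by exists (k \o h) => //=; exact: homeo_comp.
have [hc [h' [h'c hK h'K]]] := hh.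
exists (k \o h'); last by rewrite /= hK.
by apply: homeo_comp => //; split => //; exists h.
Qed.

(** * Countable intersections of neighbourhoods *)

(** Equivalently, the singleton of [y] is a G-delta set. *)
Definition Gdelta_point (Y : topologicalType) (y : Y) : Prop :=
  exists2 U : nat -> set Y, forall n, nbhs y (U n) &
    forall z, (forall n, U n z) -> z = y.

Lemma Gdelta_point_preimage (X Y : topologicalType) (h : X -> Y) x :
  continuous h -> injective h -> Gdelta_point (h x) -> Gdelta_point x.
Proof.
move=> hc hi [U Ux Ux1]; exists (fun n => h @^-1` U n) => [n|z zU].
  by apply: hc; exact: Ux.
by apply: hi; exact: Ux1.
Qed.

Section SolenoidPoints.
Context {d : Order.disp_t} (L : orderType d) (o e : L) (p : nat -> nat).
Hypotheses (oP : forall x, (o <= x)%O) (eP : forall x, (x <= e)%O).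
Hypothesis oe : o != e.

Lemma circle_pt_open n (i : 'I_n) (A : set (order_topology L)) :
  open A -> ~ A o -> ~ A e -> open (@circle_pt d L n i @` A).
Proof.
move=> oA Ao Ae.
have E : (\pi_({eq_quot (glue_equiv L n)}) : copies L n -> circle L n) @^-1`
    (@circle_pt d L n i @` A) = existT (fun=> order_topology L) i @` A.
  apply/seteqP; split=> [[j y] [x Ax /circle_ptP]|_ [x Ax <-]]; last by exists x.
  case/predU1P => [<-|/andP[]]; first by exists x.
  rewrite /node /= (is_firstE oP) (is_lastE eP).
  case: (x =P o) => [xo|_]; first by rewrite xo in Ax.
  by case: (x =P e) => [xe|//]; rewrite xe in Ax.
rewrite /open /= /quotient_open E; exact: existT_open_map.
Qed.

(** A single sequence of neighbourhoods of [x] suffices: the [n]th one, placed in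
    the copy [i n] at level [n], pins down both [x] and the thread. *)
Lemma interior_Gdelta i (it : thread (p := p) i) (x : L) : x != o -> x != e ->
  Gdelta_point (x : order_topology L) -> Gdelta_point (solenoid_pt it x).
Proof.
move=> xo xe [U Ux Ux1].
pose A n : set (order_topology L) := (U n)^° `&` ([set` `]o, e[%O]).
have oA n : open (A n).
  by apply: openI; [exact: open_interior | exact: (@itv_open _ (order_topology L))].
have Ax n : A n x.
  split; first exact: Ux.
  by rewrite /= in_itv /= !lt_def xo oP eq_sym xe eP.
exists (fun n => [set z | (@circle_pt d L _ (i n) @` A n) (val z n)]) => [n|z zA].
  apply: (@inverse_limit_proj_continuous _ _ n (solenoid_pt it x)).
  apply: open_nbhs_nbhs; split; last by exists x.
  by apply: circle_pt_open => // -[_]; rewrite /= in_itv /= ltxx ?andbF.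
have [y [j [jt [ye zE]]]] := solenoid_pt_repr oP eP oe z.
have jy n : j n = i n /\ U n y.
  have [y' [Uy' y'_oe]] := zA n; rewrite zE /= => /esym E.
  have y'e : y' != e.
    by move: y'_oe; rewrite /= in_itv /= => /andP[_ /lt_eqF ->].
  have [-> ->] := circle_pt_inj oP eP ye y'e E; split => //.
  exact: interior_subset.
rewrite zE; apply: inverse_limit_ext => n /=; rewrite (jy n).1.
by rewrite (Ux1 y)// => m; have [] := jy m.
Qed.

(** The copy of [L] that ends at a node is a path into it, so neighbourhoods of
    the node pull back to neighbourhoods of [e]. The common point found there must
    also differ from [o], which the path may send to the same node as [e]. *)
Lemma node_not_Gdelta i (it : thread (p := p) i) :
    (forall U : nat -> set (order_topology L),
      (forall n, nbhs (e : order_topology L) (U n)) ->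
      exists x : L, [/\ x != o, x != e & forall n, U n x]) ->
  ~ Gdelta_point (solenoid_pt it o).
Proof.
move=> Le [U Uo Uo1].
(* The copies just before the nodes given by [i]: [j n] is the cyclic
   predecessor of [i n], so [L] placed along [j] ends at the node. *)
pose j n := rotation (ordS (i n)) (i n) (i n).
have jt : thread (p := p) j.
  by move=> n; rewrite /j mod_ord_rotation mod_ordS it.
have jte : solenoid_pt jt e = solenoid_pt it o.
  apply: inverse_limit_ext => n /=.
  by rewrite (circle_pt_last oP eP oe) -rotation_ordS rotationE.
have [n|x [xo xe xU]] := Le (fun n => solenoid_pt jt @^-1` U n).
  by apply: (@solenoid_pt_continuous d L p j jt e); rewrite jte.
have [_ /eqP] := solenoid_pt_inj oP eP xe oe (Uo1 _ xU).
by rewrite (negbTE xo).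
Qed.

End SolenoidPoints.

(** * Initial segments of the long line are real intervals *)

Local Open Scope ring_scope.

Section WeightedSums.
Context {d : Order.disp_t} (W : orderType d) (R : realType).
Variables (a : W) (c : W -> nat).
Hypothesis c_inj : forall x y, (x < a)%O -> (y < a)%O -> c x = c y -> x = y.

Definition weight (b : W) : R := 2^-1 ^+ (c b).+1.

(** Summing over the numbers [n] instead of over ordinals makes the sum of the
    weights of the ordinals below [b] an ordinary series with nonnegative terms. *)
Definition summand (b : W) (n : nat) : R :=
  if `[< exists2 x, (x < b)%O & c x = n >] then 2^-1 ^+ n.+1 else 0.

Definition weight_below (b : W) : R :=
  sup (range (fun N => \sum_(n < N) summand b n)).

Lemma weight_gt0 b : 0 < weight b.
Proof. by rewrite exprn_gt0// invr_gt0. Qed.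

Let summand_ge0 b n : 0 <= summand b n.
Proof. by rewrite /summand; case: ifP => // _; rewrite exprn_ge0// invr_ge0. Qed.

Let has_sup_partial b : has_sup (range (fun N => \sum_(n < N) summand b n)).
Proof.
split; first by exists 0, 0%N => //; rewrite big_ord0.
exists 1 => _ [N _ <-]; apply: (@le_trans _ _ (1 - 2^-1 ^+ N)); last first.
  by rewrite gerBl exprn_ge0// invr_ge0.
elim: N => [|N IH]; first by rewrite big_ord0 expr0 subrr.
rewrite big_ord_recr /=.
have le : summand b N <= 2^-1 ^+ N.+1.
  by rewrite /summand; case: ifP => // _; rewrite exprn_ge0// invr_ge0.
apply: (le_trans (lerD IH le)); rewrite exprS; lra.
Qed.

Let partial_le b N : \sum_(n < N) summand b n <= weight_below b.
Proof. by apply: sup_upper_bound => //; exists N. Qed.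

Lemma weight_below_ge0 b : 0 <= weight_below b.
Proof. by have := partial_le b 0; rewrite big_ord0. Qed.

Let summandE x b : (b <= a)%O -> (x < b)%O -> summand b (c x) = weight x.
Proof. by move=> ba xb; rewrite /summand ifT//; apply/asboolP; exists x. Qed.

(** With [weight_below_le] below, this says that [weight_below] is the least
    function which makes room for an interval of length [weight x] above every
    [x]: the intervals [[weight_below x, weight_below x + weight x)] are in order
    and, by minimality, leave no gaps. *)
Lemma weight_below_succ x b : (b <= a)%O -> (x < b)%O ->
  weight_below x + weight x <= weight_below b.
Proof.
move=> ba xb; rewrite -lerBrDr; apply: ge_sup; first by case: (has_sup_partial x).
move=> _ [N _ <-]; rewrite lerBrDr.
apply: le_trans (partial_le b (maxn N (c x).+1)).
have le n : summand x n + (if n == c x then weight x else 0) <= summand b n.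
  have [->|nx] := eqVneq n (c x).
    rewrite [leRHS]summandE// /summand ifF ?add0r//; apply/asboolP => -[y yx].
    have xa := lt_le_trans xb ba.
    by move=> /(c_inj (lt_trans yx xa) xa) e; rewrite e ltxx in yx.
  rewrite addr0 {1}/summand.
  case: asboolP => [[y yx yn]|_]; last exact: summand_ge0.
  by rewrite /summand ifT//; apply/asboolP; exists y => //; exact: lt_trans xb.
apply: (le_trans _ (ler_sum _ (fun (n : 'I__) _ => le n))).
rewrite big_split /=; apply: lerD.
  rewrite (big_ord_widen _ (fun n => summand x n) (leq_maxl N (c x).+1)).
  rewrite big_mkcond /=.
  by apply: ler_sum => n _; case: ifP.
have xN : (c x < maxn N (c x).+1)%N by rewrite leq_max leqnn orbT.
rewrite (bigD1 (Ordinal xN))//= eqxx lerDl; apply: sumr_ge0 => n _.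
by case: ifP => // _; rewrite ltW// weight_gt0.
Qed.

Lemma weight_below_le (y : R) b : 0 <= y -> (b <= a)%O ->
  (forall x, (x < b)%O -> weight_below x + weight x <= y) -> weight_below b <= y.
Proof.
move=> y0 ba yP; apply: ge_sup; first by case: (has_sup_partial b).
move=> _ [N _ <-].
have [[x0 x0b]|b0] := pselect (exists x, (x < b)%O); last first.
  rewrite big1// => n _; rewrite /summand ifF//.
  by apply/asboolP => -[x xb]; case: b0; exists x.
(* Only finitely many ordinals contribute to a partial sum, so some [x] below [b]
   bounds them all, and the partial sum is at most the total up to [x] included. *)
have [x xb xmax] : exists2 x, (x < b)%O &
    forall z, (z < b)%O -> (c z < N)%N -> (z <= x)%O.
  elim: N => [|N [x xb xmax]]; first by exists x0.
  have [[z zb zN]|Nz] := pselect (exists2 z, (z < b)%O & c z = N); last first.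
    exists x => // z zb; rewrite ltnS leq_eqVlt => /predU1P[zN|]; last exact: xmax.
    by case: Nz; exists z.
  exists (Order.max x z); first by rewrite gt_max xb.
  move=> t tb; rewrite ltnS leq_eqVlt le_max => /predU1P[tN|/xmax->//].
  by rewrite (c_inj (lt_le_trans tb ba) (lt_le_trans zb ba)) ?lexx ?orbT// tN zN.
apply: le_trans (yP _ xb).
have le (n : 'I_N) :
    summand b n <= summand x n + (if n == c x :> nat then weight x else 0).
  rewrite {1}/summand; case: asboolP => [[z zb zn]|_]; last first.
    rewrite addr_ge0// ?summand_ge0//; case: ifP => // _.
    by rewrite ltW// weight_gt0.
  have := xmax z zb; rewrite zn ltn_ord le_eqVlt => /(_ isT) /predU1P[zx|zx].
    by rewrite -zn zx eqxx lerDr summand_ge0.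
  rewrite {1}/summand ifT ?lerDl; last by apply/asboolP; exists z.
  by case: ifP => // _; rewrite ltW// weight_gt0.
apply: (le_trans (ler_sum _ (fun n _ => le n))).
rewrite big_split /=; apply: lerD; first exact: partial_le.
rewrite -big_mkcond /=.
have [xN|xN] := ltnP (c x) N.
  rewrite (bigD1 (Ordinal xN))//= big1 ?addr0// => n /andP[/eqP nx].
  by rewrite -val_eqE /= nx eqxx.
rewrite big1 ?ltW ?weight_gt0// => n /eqP nx.
by have := ltn_ord n; rewrite nx ltnNge xN.
Qed.

End WeightedSums.

Section Segment.
Context {d : Order.disp_t} (W : orderType d) (R : realType).
Local Notation LL := (W *lexi[Order.lexi_display d ring_display] unit_Ico R)%type.
Implicit Types x y : LL.

Definition Ico_pt (t : R) (h : 0 <= t < 1) : unit_Ico R := exist _ t h.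

Lemma long_line_leE x y :
  (x <= y)%O = (x.1 < y.1)%O || (x.1 == y.1) && (val x.2 <= val y.2).
Proof.
rewrite leEprodlexi; by case: (ltgtP x.1 y.1).
Qed.

Lemma long_line_ltE x y :
  (x < y)%O = (x.1 < y.1)%O || (x.1 == y.1) && (val x.2 < val y.2).
Proof.
rewrite ltEprodlexi; by case: (ltgtP x.1 y.1).
Qed.

(** The map sends [(b, t)] to the weight below [b] plus [t] times the weight of
    [b]. It is onto: the first ordinal whose interval reaches beyond [r] has an
    interval that contains [r]. *)
Lemma segment_embedding (a : W)
    (wf : forall A : set W, A !=set0 ->
      exists2 b, A b & forall b', A b' -> (b <= b')%O) :
    countable [set y : W | (y < a)%O] ->
  exists (T : R) (F : LL -> R) (G : R -> LL),
    [/\ forall x, (x.1 < a)%O -> 0 <= F x < T,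
        forall x y, (x.1 < a)%O -> (y.1 < a)%O -> (x < y)%O -> F x < F y
      & forall r, 0 <= r < T -> ((G r).1 < a)%O /\ F (G r) = r].
Proof.
move=> /countable_injP[c c_inj].
have {}c_inj (x y : W) : (x < a)%O -> (y < a)%O -> c x = c y -> x = y.
  by move=> xa ya; apply: c_inj; rewrite inE.
pose S := weight_below R c; pose w := weight R c.
have w0 b : 0 < w b by exact: weight_gt0.
have S0 b : 0 <= S b by exact: weight_below_ge0.
have Sw (x b : W) : (b <= a)%O -> (x < b)%O -> S x + w x <= S b.
  exact: (weight_below_succ R c_inj).
pose F x : R := S x.1 + val x.2 * w x.1.
have F_ge x : S x.1 <= F x.
  by rewrite lerDl mulr_ge0 ?(ltW (w0 _))//; have /andP[] := valP x.2.
have F_lt x : F x < S x.1 + w x.1.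
  by rewrite ltrD2l gtr_pMl//; have /andP[] := valP x.2.
have G (r : R) : exists x : LL, 0 <= r < S a -> (x.1 < a)%O /\ F x = r.
  have [/andP[r0 rT]|nr] := pselect (is_true (0 <= r < S a)); last first.
    have h : 0 <= (0 : R) < 1 by rewrite lexx ltr01.
    by exists (a, Ico_pt h).
  have [|b [ba rb] bmin] := wf [set b | (b < a)%O /\ r < S b + w b].
    apply: contrapT => h; suff : S a <= r by rewrite leNgt rT.
    apply: (weight_below_le c_inj) => // x xa; rewrite leNgt; apply/negP => rx.
    by apply: h; exists x.
  have Sb : S b <= r.
    apply: (weight_below_le c_inj) => // [|x xb]; first exact: ltW.
    rewrite leNgt; apply/negP => rx; suff : (b <= x)%O by rewrite leNgt xb.
    by apply: bmin; split => //; exact: lt_trans ba.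
  have h : 0 <= (r - S b) / w b < 1.
    by rewrite divr_ge0 ?subr_ge0 ?(ltW (w0 _))//= ltr_pdivrMr// mul1r ltrBlDl.
  exists (b, Ico_pt h) => _; split=> //; rewrite /F /=.
  by rewrite divfK ?subrKC// gt_eqF.
exists (S a), F, (fun r => sval (cid (G r))); split.
- by move=> x xa; rewrite (le_trans (S0 _) (F_ge x)) (lt_le_trans (F_lt x))// Sw.
- move=> x y xa ya; rewrite long_line_ltE => /orP[xy|/andP[/eqP e xy]].
    by apply: lt_le_trans (F_lt x) (le_trans _ (F_ge y)); rewrite Sw// ltW.
  by rewrite /F e ltrD2l ltr_pM2r.
- by move=> r; exact: (svalP (cid (G r))).
Qed.

End Segment.

(** * Order automorphisms of a real interval *)

Section PiecewiseLinear.
Variables (R : realType) (T : R).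

(** The increasing bijection of [0, T) that maps [a] to [b] and is affine on
    [0, a] and on [a, T). *)
Definition bend (a b r : R) : R :=
  if r <= a then r * (b / a) else T - (T - r) * ((T - b) / (T - a)).

Lemma bendE a b : 0 < a -> bend a b a = b.
Proof. by move=> a0; rewrite /bend lexx mulrCA divff ?mulr1// gt_eqF. Qed.

Variables (a b : R).
Hypotheses (aT : 0 < a < T) (bT : 0 < b < T).

Let le_bend r : (bend a b r <= b) = (r <= a).
Proof.
case/andP: aT bT => a0 aT' /andP[b0 bT'].
rewrite /bend; case: (leP r a) => ra.
  by rewrite mulrCA ger_pMr// ler_pdivrMr// mul1r.
rewrite lerBlDr -lerBlDl mulrCA ler_pMr ?subr_gt0//.
by rewrite ler_pdivlMr ?subr_gt0// mul1r; apply/negbTE; rewrite -ltNge; lra.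
Qed.

Lemma bendK : cancel (bend a b) (bend b a).
Proof.
move=> r; rewrite {1}/bend le_bend /bend.
case/andP: aT bT => a0 aT' /andP[b0 bT'].
by case: (leP r a) => ra; field; rewrite ?subr_eq0 ?gt_eqF.
Qed.

Lemma bend_lt r s : r < s -> bend a b r < bend a b s.
Proof.
case/andP: aT bT => a0 aT' /andP[b0 bT'] rs.
have u0 : 0 < b / a by rewrite divr_gt0.
have v0 : 0 < (T - b) / (T - a) by rewrite divr_gt0 ?subr_gt0.
have [sa|sa] := leP s a.
  by rewrite /bend sa (ltW (lt_le_trans rs sa)) ltr_pM2r.
have [ra|ra] := leP r a; last first.
  by rewrite /bend !leNgt ra sa /= ltrD2l ltrN2 ltr_pM2r// ltrD2l ltrN2.
by apply: (@le_lt_trans _ _ b); rewrite ?le_bend// ltNge le_bend -ltNge.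
Qed.

Lemma bend_itv r : 0 <= r < T -> 0 <= bend a b r < T.
Proof.
case/andP: aT bT => a0 aT' /andP[b0 bT'] /andP[r0 rT].
have b0E : bend a b 0 = 0 by rewrite /bend (ltW a0) mul0r.
have bTE : bend a b T = T by rewrite /bend leNgt aT' subrr mul0r subr0.
rewrite -[ltRHS]bTE bend_lt// andbT.
by move: r0; rewrite le_eqVlt => /predU1P[<-|/bend_lt/ltW]; rewrite b0E.
Qed.

End PiecewiseLinear.

(** * The closed long line *)

Section ClosedLongLine.
Context {d : Order.disp_t} (W : orderType d) (R : realType).
Hypothesis omega1W : is_omega1 W.
Local Notation LL := (W *lexi[Order.lexi_display d ring_display] unit_Ico R)%type.
Local Notation L := (closed_long_line W R).

Definition long_pt (x : LL) : L := Some x.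
Definition omega1_pt : L := None.

Lemma long_pt_le x y : (long_pt x <= long_pt y)%O = (x <= y)%O.
Proof. by []. Qed.

Lemma long_pt_lt x y : (long_pt x < long_pt y)%O = (x < y)%O.
Proof. by rewrite !lt_neqAle long_pt_le. Qed.

Lemma omega1_pt_last x : (x <= omega1_pt)%O.
Proof. by case: x. Qed.

Lemma omega1_countable_bounded (b : nat -> W) : exists w, forall n, (b n < w)%O.
Proof.
apply: contrapT => nb; case: omega1W => _ + cW; apply.
apply: (@sub_countable _ _ _ (\bigcup_n ([set y | (y < b n)%O] `|` [set b n]))).
  apply: subset_card_le => w _; apply: contrapT => nw; apply: nb; exists w => n.
  rewrite ltNge; apply/negP; rewrite le_eqVlt => /predU1P[wb|wb]; apply: nw.
    by exists n => //; right.
  by exists n => //; left.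
apply: bigcup_countable => // n _; rewrite -bigcup2E.
by apply: bigcup_countable => // -[|[|i]] _ //=; exact: cW.
Qed.

Lemma Ico_zero_subproof : 0 <= (0 : R) < 1.
Proof. by rewrite lexx ltr01. Qed.

Variable w0 : W.
Hypothesis w0P : forall w, (w0 <= w)%O.

Definition origin : LL := (w0, Ico_pt Ico_zero_subproof).

Definition first_pt : L := long_pt origin.

Lemma first_ptP x : (first_pt <= x)%O.
Proof.
case: x => [[w t]|//]; rewrite [(_ <= _)%O]long_pt_le long_line_leE /=.
have := w0P w; rewrite le_eqVlt => /orP[/eqP->|->//].
by rewrite eqxx; have /andP[->] := valP t; rewrite orbT.
Qed.

Lemma first_pt_neq_last : first_pt != omega1_pt.
Proof. by []. Qed.

(** Each neighbourhood of [omega1_pt] contains all points beyond some countable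
    ordinal, and countably many such ordinals have a common upper bound. *)
Lemma omega1_pt_countable_nbhs (U : nat -> set (order_topology L)) :
    (forall n, nbhs (omega1_pt : order_topology L) (U n)) ->
  exists x : L, [/\ x != first_pt, x != omega1_pt & forall n, U n x].
Proof.
move=> Ue.
have Ub n : exists b : W, forall w t, (b < w)%O -> U n (long_pt (w, t)).
  have := Ue n; rewrite order_nbhs_itv => -[[l r] [lr_open lr_e] lrU].
  exists (if l is BSide _ (Some (w, _)) then w else w0) => w t bw.
  apply: lrU => /=; rewrite !inE /= in lr_e *.
  case/andP: lr_e => l_e e_r; apply/andP; split.
    case: l lr_open l_e bw => [[] [[b s]|]|[]] //= _ _ bw.
    by rewrite bnd_simp [(_ < _)%O]long_pt_lt long_line_ltE bw.
  by case: r lr_open e_r => [[] [[b s]|]|[]] //= _ _; case: l {l_e bw} => [[]|[]].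
have [w wP] := omega1_countable_bounded (fun n => sval (cid (Ub n))).
exists (long_pt (w, Ico_pt Ico_zero_subproof)); split => //.
  by apply/negP => /eqP [ww0]; have := wP 0%N; rewrite ww0 ltNge w0P.
by move=> n; apply: (svalP (cid (Ub n))); exact: wP.
Qed.

(** Both points lie in an initial segment that is isomorphic to a real interval,
    where [bend] moves one to the other. *)
Lemma interior_homogeneous (x y : L) :
    x != first_pt -> x != omega1_pt -> y != first_pt -> y != omega1_pt ->
  exists f g, order_auto f g /\ f x = y.
Proof.
have pos (z : LL) : long_pt z != first_pt -> (first_pt < long_pt z)%O.
  by move=> z0; rewrite lt_neqAle eq_sym z0 first_ptP.
case: x => [x|//] /pos x0 _; case: y => [y|//] /pos y0 _.
rewrite !long_pt_lt in x0 y0.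
have [a aP] :=
  omega1_countable_bounded (fun n => if n is 0%N then x.1 else y.1).
have [xa ya] : (x.1 < a)%O /\ (y.1 < a)%O.
  by split; [exact: (aP 0%N) | exact: (aP 1%N)].
have [wf _ cW] := omega1W.
have [T [F [G [FT F_lt FG]]]] := segment_embedding R wf (cW a).
have o_a : (w0 < a)%O by exact: le_lt_trans xa.
have Fpos (z : LL) : (z.1 < a)%O -> (origin < z)%O -> 0 < F z < T.
  move=> za z0; have /andP[_ ->] := FT z za; rewrite andbT.
  apply: le_lt_trans (F_lt _ _ _ za z0) => //.
  by have /andP[] := FT origin o_a.
have Fx := Fpos x xa x0; have Fy := Fpos y ya y0.
have GF (z : LL) : (z.1 < a)%O -> G (F z) = z.
  move=> za; have [Ga FGz] := FG _ (FT z za).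
  case: (ltgtP (G (F z)) z) => [/(F_lt _ _ Ga za)|/(F_lt _ _ za Ga)|//];
    by rewrite FGz ltxx.
(* Conjugating [bend] by [F] and extending by the identity from [a] onwards. *)
pose h (A B : R) (z : L) : L :=
  if z is Some z'
  then long_pt (if (z'.1 < a)%O then G (bend T A B (F z')) else z')
  else omega1_pt.
have hK A B : 0 < A < T -> 0 < B < T -> cancel (h A B) (h B A).
  move=> AT BT [z|//]; rewrite /h /=.
  have [za|za] := ltP z.1 a; last by rewrite ltNge za.
  have [ga gF] := FG _ (bend_itv AT BT (FT z za)).
  by rewrite ga gF bendK// GF.
have hm A B : 0 < A < T -> 0 < B < T -> {mono h A B : s t / (s <= t)%O}.
  move=> AT BT; apply: le_mono => -[s|] [t|] //.
  rewrite -/(long_pt s) -/(long_pt t) long_pt_lt => st.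
  rewrite /h /= long_pt_lt.
  have st1 : (s.1 <= t.1)%O.
    by move: st; rewrite long_line_ltE le_eqVlt => /orP[|/andP[]] ->; rewrite ?orbT.
  have [ta|ta] := ltP t.1 a; last first.
    have [sa|//] := ltP s.1 a.
    have [ga _] := FG _ (bend_itv AT BT (FT s sa)).
    by rewrite long_line_ltE (lt_le_trans ga ta).
  have sa := le_lt_trans st1 ta; rewrite sa.
  have [gsa gsF] := FG _ (bend_itv AT BT (FT s sa)).
  have [gta gtF] := FG _ (bend_itv AT BT (FT t ta)).
  rewrite ltNge; apply/negP; rewrite le_eqVlt => /predU1P[E|/(F_lt _ _ gta gsa)].
    have := bend_lt AT BT (F_lt _ _ sa ta st).
    by rewrite -gsF -gtF E ltxx.
  by rewrite gsF gtF ltNge ltW// bend_lt// F_lt.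
exists (h (F x) (F y)), (h (F y) (F x)); split.
  by split; [exact: hm | exact: hK | exact: hK].
rewrite /h xa bendE ?GF//; by case/andP: Fx.
Qed.

Lemma Ico_half_subproof : 0 <= (2^-1 : R) < 1.
Proof. by rewrite invr_ge0 ler0n invf_lt1 ?ltr1n. Qed.

(** A sample interior point, chosen inside a copy of the real interval (0, 1) so
    that its small neighbourhoods are real intervals. *)
Definition half_pt : L := long_pt (w0, Ico_pt Ico_half_subproof).

Lemma half_pt_neq_first : half_pt != first_pt.
Proof.
by apply/negP => /eqP [] /eqP; rewrite invr_eq0 pnatr_eq0.
Qed.

Lemma half_pt_Gdelta : Gdelta_point (half_pt : order_topology L).
Proof.
(* The offsets start at 1/3 so that 1/2 - 1/(n+3) and 1/2 + 1/(n+3) stay in the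
   half-open unit interval. *)
have n3 n : 0 < n.+3%:R^-1 :> R by rewrite invr_gt0 ltr0n.
have n2 n : n.+3%:R^-1 < 2^-1 :> R by rewrite ltf_pV2 ?posrE ?ltr0n// ltr_nat.
have lP n : 0 <= (2^-1 - n.+3%:R^-1 : R) < 1.
  by move: (n3 n) (n2 n); move: n.+3%:R^-1 => u *; apply/andP; split; lra.
have rP n : 0 <= (2^-1 + n.+3%:R^-1 : R) < 1.
  by move: (n3 n) (n2 n); move: n.+3%:R^-1 => u *; apply/andP; split; lra.
pose l n := long_pt (w0, Ico_pt (lP n)); pose r n := long_pt (w0, Ico_pt (rP n)).
exists (fun n => [set` `]l n, r n[%O]) => [n|[[w t]|] zlr].
- apply: open_nbhs_nbhs; split; first exact: (@itv_open _ (order_topology L)).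
  rewrite /= in_itv /= [X in X && _]long_pt_lt [X in _ && X]long_pt_lt.
  rewrite !long_line_ltE /= ltxx eqxx /= gtrBl ltrDl.
  by rewrite !n3.
- have {}zlr n : w = w0 /\ `|2^-1 - val t| < n.+3%:R^-1.
    have := zlr n; rewrite /= in_itv /= -/(long_pt (w, t)) /l /r !long_pt_lt.
    rewrite !long_line_ltE /= (ltNge w) w0P /= => /andP[tl /andP[/eqP ww tr]].
    move: tl; rewrite ww ltxx eqxx /= => tl; split=> //.
    rewrite ltr_norml; move: tl tr; move: n.+3%:R^-1 (sval t) => u v tl tr.
    by apply/andP; split; lra.
  have [-> _] := zlr 0%N; congr (long_pt (_, _)); apply/val_inj => /=.
  apply/esym/eqP; rewrite -subr_eq0 -normr_eq0 eq_le normr_ge0 andbT leNgt.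
  apply/negP => t0; have [_] := zlr (Num.bound (`|2^-1 - val t|^-1)).
  rewrite ltNge => /negP; apply.
  rewrite invf_ple ?posrE ?ltr0n//; apply: ltW.
  apply: lt_le_trans (archi_boundP _) _; first by rewrite invr_ge0.
  by rewrite ler_nat -addn3 leq_addr.
- by have := zlr 0%N; rewrite /= in_itv /= => /andP[].
Qed.

End ClosedLongLine.

(** * Two orbits *)

Theorem theorem2p2 (R : realType) (d : Order.disp_t) (W : orderType d)
    (omega1W : is_omega1 W) (p : nat -> nat) (p_gt0 : forall n, (0 < p n)%N) :
  frac_homogeneous `I_2 (solenoid (closed_long_line W R) p).
Proof.
have [wf W_unc _] := omega1W.
have [w0 _ w0min] : exists2 w : W, setT w & forall w', setT w' -> (w <= w')%O.
  apply: wf; apply: contrapT => W0; apply: W_unc.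
  rewrite (_ : [set: W] = set0)//; apply/seteqP; split=> // w _.
  by apply: W0; exists w.
have w0P w : (w0 <= w)%O by exact: w0min.
have deg_gt0 n : (0 < degree p n)%N by elim: n => //= n IH; rewrite muln_gt0 p_gt0.
pose i0 n : 'I_(degree p n) := Ordinal (deg_gt0 n).
have i0t : thread i0 by move=> n; apply/val_inj; rewrite /= mod0n.
pose o := first_pt R w0; pose e := omega1_pt W R; pose m := half_pt R w0.
have oP := first_ptP (R := R) w0P; have eP := @omega1_pt_last _ W R.
have oe : o != e by exact: first_pt_neq_last.
pose zo := solenoid_pt i0t o; pose zm := solenoid_pt i0t m.
have orbits z : homeo_orbit z = homeo_orbit zo \/ homeo_orbit z = homeo_orbit zm.
  have [x [i [it [xe ->]]]] := solenoid_pt_repr oP eP oe z.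
  have [->|xo] := eqVneq x o.
    have [h hh hE] := solenoid_pt_homeo i0t it o
      (order_auto_id (closed_long_line W R)).
    by left; rewrite -hE homeo_orbit_eq.
  have [f [g [fg <-]]] :=
    interior_homogeneous omega1W w0P (half_pt_neq_first R w0) isT xo xe.
  have [h hh <-] := solenoid_pt_homeo i0t it m fg.
  by right; rewrite homeo_orbit_eq.
have zo_zm : homeo_orbit zo != homeo_orbit zm.
  apply/eqP => E; have : homeo_orbit zo zm by rewrite E; exact: homeo_orbit_refl.
  move=> [h /= [hc [h' [_ hK _]]] hE].
  apply: (node_not_Gdelta oP eP oe (it := i0t)
    (omega1_pt_countable_nbhs omega1W w0P)).
  apply: (Gdelta_point_preimage hc (can_inj hK)); rewrite hE.
  apply: (interior_Gdelta oP eP oe i0t _ _ (half_pt_Gdelta R w0P)) => //.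
  exact: half_pt_neq_first.
rewrite /frac_homogeneous.
have -> : range (@homeo_orbit (solenoid (closed_long_line W R) p)) =
    [set` [fset homeo_orbit zo; homeo_orbit zm]%fset].
  apply/seteqP; split=> [_ [z _ <-]|O] /=; rewrite !inE.
    by case: (orbits z) => ->; rewrite eqxx ?orbT.
  by move=> /orP[] /eqP ->; [exists zo | exists zm].
by apply/card_eq_fsetP; rewrite cardfs2 zo_zm.
Qed.
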